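(* There exist a non-empty finite set $C$ and two prefix-independent bi-positional winning conditions $W_1, W_2\subseteq C^\omega$, both of which are energy conditions over (total orderings of) the free group with $2$ generators, such that the union $W_1\cup W_2$ is not half-positional.
   Context: For a set $C$, $C^*$, $C^+$, $C^\omega$ denote the sets of finite, finite non-empty, and infinite words over $C$. **Arenas and games.** An arena over a non-empty finite set (of colors) $C$ is a tuple $\langle V_A,V_B,E\rangle$ where $V_A,V_B$ are disjoint finite sets and $E\subseteq (V_A\cup V_B)\times C\times (V_A\cup V_B)$ is such that every $s\in V_A\cup V_B$ has some $(s,c,t)\in E$. Nodes in $V_A$ are Alice's, nodes in $V_B$ are Bob's. For an edge $e=(s,c,t)$, put $\mathrm{source}(e)=s$, $\mathrm{col}(e)=c$, $\mathrm{target}(e)=t$. The infinite-duration game from a node $s$: starting at $s$, at each turn the owner of the current node chooses an edge whose source is the current node, and the play moves to the target of this edge. This gives an infinite path $e_1,e_2,e_3,\ldots$ (a play). A strategy of a player selects an edge at each of that player's turns depending on the path so far. A winning condition is a set $W\subseteq C^\omega$. A strategy of Alice is winning from $s$ w.r.t. $W$ if every play from $s$ consistent with it satisfies $\mathrm{col}(e_1)\mathrm{col}(e_2)\mathrm{col}(e_3)\ldots\in W$; a strategy of Bob is winning from $s$ w.r.t. $W$ if every play from $s$ consistent with it satisfies $\mathrm{col}(e_1)\mathrm{col}(e_2)\ldots\notin W$. A positional strategy of Alice is a function $\sigma\colon V_A\to E$ with $\mathrm{source}(\sigma(u))=u$ for all $u\in V_A$ (whenever at $u$, Alice chooses $\sigma(u)$);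 positional strategies of Bob are defined analogously on $V_B$. $W$ is half-positional if for every (finite) arena over $C$ there is a positional strategy $\sigma$ of Alice such that for every node $s$: if $\sigma$ is not winning w.r.t. $W$ from $s$, then Bob has a winning strategy w.r.t. $W$ from $s$. $W$ is bi-positional if both $W$ and $C^\omega\setminus W$ are half-positional. $W$ is prefix-independent if for all $x\in C^*$, $\alpha\in C^\omega$: $\alpha\in W\iff x\alpha\in W$. **Energy conditions.** A totally ordered group is a triple $(G,+,\le)$ where $(G,+)$ is a (not necessarily abelian) group and $\le$ is a total order on $G$ such that $a\le b$ implies $x+a+y\le x+b+y$ for all $a,b,x,y\in G$. A valuation of colors is a function $\mathrm{val}\colon C\to G$, extended to $C^*$ by $\mathrm{val}(\text{empty word})=0$, $\mathrm{val}(c_1\ldots c_n)=\mathrm{val}(c_1)+\ldots+\mathrm{val}(c_n)$. The energy condition over $(G,+,\le)$ defined by $\mathrm{val}$ is the set of all $c_1c_2c_3\ldots\in C^\omega$ such that the sequence $\{\mathrm{val}(c_1\ldots c_n)\}_{n=1}^\infty$ has an infinite (strictly) decreasing subsequence w.r.t. $\le$. *)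

(* Defs.v *)
From HB Require Import structures.
From mathcomp Require Import all_boot.
From mathcomp Require Import classical_sets.

Set Implicit Arguments.
Unset Strict Implicit.
Unset Printing Implicit Defensive.

Local Open Scope classical_set_scope.
Local Open Scope group_scope.

(* An infinite word over C is a function nat -> C: the word c_1 c_2 c_3 ... is
   represented by n |-> c_(n+1), so that mkseq alpha n is its prefix of
   length n. *)

(* The default value of nth takes over from position size x on, so this is the
   word x followed by alpha. *)
Definition prepend (C : Type) (x : seq C) (alpha : nat -> C) : nat -> C :=
  fun n => nth (alpha (n - size x)) x n.

Definition prefix_independent (C : Type) (W : set (nat -> C)) : Prop :=
  forall (x : seq C) (alpha : nat -> C), W alpha <-> W (prepend x alpha).

(* The disjoint sets V_A and V_B are given as two types, and the set of nodes
   is their sum. *)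
Record arena (C : finType) := Arena {
  alice_nodes : finType;
  bob_nodes : finType;
  edges : {set (alice_nodes + bob_nodes) * C * (alice_nodes + bob_nodes)};
  edges_total : forall s : alice_nodes + bob_nodes,
    exists c t, (s, c, t) \in edges
}.

Inductive player := Alice | Bob.

Section Games.
Variables (C : finType) (A : arena C).

Definition node : finType := (alice_nodes A + bob_nodes A)%type.

Definition edge : finType := {e : node * C * node | e \in edges A}.

Definition source (e : edge) : node := (val e).1.1.
Definition col (e : edge) : C := (val e).1.2.
Definition target (e : edge) : node := (val e).2.

Definition owned (P : player) : finType :=
  match P with Alice => alice_nodes A | Bob => bob_nodes A end.

Definition owned_node (P : player) : owned P -> node :=
  match P with Alice => inl | Bob => inr end.

(* move h u is the edge chosen at the node u after the path h. Legality of the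
   choice is demanded for all pairs h, u, even those where h does not lead to
   u; this is harmless since every node has an outgoing edge. *)
Record strategy (P : player) := Strategy {
  move :> seq edge -> owned P -> edge;
  source_move : forall h u, source (move h u) = owned_node u
}.

Record positional_strategy (P : player) := PositionalStrategy {
  pos_move : owned P -> edge;
  source_pos_move : forall u, source (pos_move u) = owned_node u
}.

Definition strategy_of_positional (P : player) (sigma : positional_strategy P) :
    strategy P :=
  Strategy (fun _ : seq edge => source_pos_move sigma).

Definition play_from (s : node) (pi : nat -> edge) : Prop :=
  source (pi 0) = s /\ forall n, source (pi n.+1) = target (pi n).

Definition consistent (P : player) (tau : strategy P) (pi : nat -> edge) : Prop :=
  forall n (u : owned P),
    source (pi n) = owned_node u -> pi n = tau (mkseq pi n) u.

Definition objective (P : player) (W : set (nat -> C)) : set (nat -> C) :=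
  match P with Alice => W | Bob => ~` W end.

Definition winning (P : player) (W : set (nat -> C)) (tau : strategy P)
    (s : node) : Prop :=
  forall pi : nat -> edge,
    play_from s pi -> consistent tau pi -> objective P W (col \o pi).

End Games.

Definition half_positional (C : finType) (W : set (nat -> C)) : Prop :=
  forall A : arena C, exists sigma : positional_strategy A Alice,
  forall s : node A,
    ~ winning W (strategy_of_positional sigma) s ->
    exists tau : strategy A Bob, winning W tau s.

Definition bi_positional (C : finType) (W : set (nat -> C)) : Prop :=
  half_positional W /\ half_positional (~` W).

(* Groups are written multiplicatively. *)
Definition total_group_order (G : groupType) (le : rel G) : Prop :=
  [/\ antisymmetric le, transitive le, total le &
      forall a b x y : G, le a b -> le (x * a * y) (x * b * y)].

Definition val_word (C : Type) (G : groupType) (v : C -> G) (w : seq C) : G :=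
  \prod_(c <- w) v c.

(* phi k + 1 >= 1 is the length of the k-th prefix of the subsequence. *)
Definition energy_condition (C : Type) (G : groupType) (le : rel G)
    (v : C -> G) : set (nat -> C) :=
  [set alpha | exists phi : nat -> nat,
    {homo phi : i j / i < j} /\
    forall k, let a := val_word v (mkseq alpha (phi k).+1) in
              let b := val_word v (mkseq alpha (phi k.+1).+1) in
              le b a /\ b <> a].

Definition is_energy_condition_over (G : groupType) (C : Type)
    (W : set (nat -> C)) : Prop :=
  exists (le : rel G) (v : C -> G),
    total_group_order le /\ W = energy_condition le v.

(* The free group on X, as the set of reduced words over the letters (x, b),
   where (x, true) stands for the generator x and (x, false) for its inverse.
   The product is concatenation followed by reduction. *)
Section FreeGroup.
Variable X : choiceType.

Notation letter := (X * bool)%type.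

Definition inv_letter (l : letter) : letter := (l.1, ~~ l.2).

Definition reduced : pred (seq letter) :=
  sorted (fun l l' => l' != inv_letter l).

Record free_group := FreeGroup {
  letters : seq letter;
  letters_reduced : reduced letters
}.

HB.instance Definition _ := [isSub for letters].
HB.instance Definition _ := [Choice of free_group by <:].

(* Left multiplication of a reduced word by a letter. *)
Definition push_letter (l : letter) (w : seq letter) : seq letter :=
  if w is l' :: w' then if l' == inv_letter l then w' else l :: w else [:: l].

Lemma inv_letterK : involutive inv_letter.
Proof. by case=> x b; rewrite /inv_letter /= negbK. Qed.

Lemma reduced_push l w : reduced w -> reduced (push_letter l w).
Proof.
case: w => //= l' w; case: ifP => [_|/negbT h]; first exact: path_sorted.
by rewrite /= h.
Qed.

Lemma reduced_foldr u v : reduced v -> reduced (foldr push_letter v u).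
Proof. by move=> v_red; elim: u => //= l u; apply: reduced_push. Qed.

Lemma push_letterK l w :
  reduced w -> push_letter l (push_letter (inv_letter l) w) = w.
Proof.
case: w => [|l' w] /=; first by rewrite eqxx.
rewrite inv_letterK; case: eqVneq => [->|_ _]; last by rewrite /= eqxx.
by case: w => //= l'' w /andP[/negPf ->].
Qed.

Lemma foldr_push l u v : reduced v ->
  foldr push_letter v (push_letter l u) =
  push_letter l (foldr push_letter v u).
Proof.
move=> v_red; case: u => //= l' u; case: eqP => //= ->.
by rewrite push_letterK //; apply: reduced_foldr.
Qed.

Lemma foldr_reduced u : reduced u -> foldr push_letter [::] u = u.
Proof.
elim: u => //= l u IHu lu_red; rewrite IHu; last exact: path_sorted lu_red.
by case: u lu_red {IHu} => //= l' u /andP[/negPf ->].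
Qed.

Definition free_one := @FreeGroup [::] isT.

Definition free_mul (u v : free_group) :=
  FreeGroup (reduced_foldr (letters u) (letters_reduced v)).

Lemma reduced_inv (u : seq letter) :
  reduced u -> reduced (rev (map inv_letter u)).
Proof.
rewrite /reduced rev_sorted sorted_map => u_red.
apply: sub_sorted u_red => l l' /=.
by rewrite inv_letterK eq_sym (can2_eq inv_letterK inv_letterK).
Qed.

Definition free_inv (u : free_group) :=
  FreeGroup (reduced_inv (letters_reduced u)).

Lemma free_mulA : associative free_mul.
Proof.
move=> [u u_red] [v v_red] [w w_red]; apply: val_inj => /=.
by elim: u {u_red} => //= l u ->; rewrite foldr_push.
Qed.

Lemma free_mul1 : left_id free_one free_mul.
Proof. by move=> u; apply: val_inj. Qed.

Lemma free_mulr1 : right_id free_one free_mul.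
Proof. by move=> [u u_red]; apply: val_inj; apply: foldr_reduced. Qed.

Lemma free_mulrV : right_inverse free_one free_inv free_mul.
Proof.
move=> [u u_red]; apply: val_inj => /=.
suff main v : reduced v -> foldr push_letter
    (foldr push_letter v (rev (map inv_letter u))) u = v.
  by rewrite -[RHS](main [::]) // (foldr_reduced (reduced_inv u_red)).
elim: u {u_red} v => //= l u IHu v v_red.
rewrite rev_cons -cats1 foldr_cat /= IHu ?push_letterK //.
exact: reduced_push.
Qed.

Lemma free_invK : involutive free_inv.
Proof.
move=> [u u_red]; apply: val_inj => /=.
by rewrite map_rev revK -map_comp map_id_in // => l _; apply: inv_letterK.
Qed.

Lemma free_mulV : left_inverse free_one free_inv free_mul.
Proof. by move=> u; rewrite -{2}[u]free_invK free_mulrV. Qed.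

HB.instance Definition _ := isGroup.Build free_group
  free_mulA free_mul1 free_mulr1 free_mulV free_mulrV.

End FreeGroup.

(* Main.v *)
From HB Require Import structures.
From mathcomp Require Import all_boot all_order all_algebra zify.
Require Import Defs.
From mathcomp Require Import boolp classical_sets.

Set Implicit Arguments.
Unset Strict Implicit.
Unset Printing Implicit Defensive.

Local Open Scope group_scope.

(** The two conditions are given by an order of the free group on x_0, x_1 and
by the opposite order, with the same valuation. An injective sequence in a
total order has a strictly monotone subsequence, so a word lies in the union
as soon as its prefixes take infinitely many values ([energy_union]), whereas
it lies outside as soon as they take at most two
([two_values_not_energy]).

In the arena [duel], Alice repeatedly chooses an index i, and Bob then chooses
between x_i and its inverse. If Alice always chooses the same i, Bob takes x_i
and its inverse in turn, and only two values occur. If she takes the two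
indices in turn, every product is a reduced word whatever Bob does, and
infinitely many values occur. So Alice has a winning strategy, but no
positional one.

Energy conditions over any totally ordered group G are bi-positional, and
prefix-independent because left translations preserve the order. Their
bi-positionality rests on certificates: a region R, one choice of edge per node
and a potential a from nodes to a group, such that the choices of the winning
side keep the play on its side of R and make (value of the prefix) * (potential
of the current node) strictly increase in R and strictly decrease outside R.
Two visits to the same node are then comparable, which decides the energy
condition by the pigeonhole principle ([energy_play]). A certificate exists for
every arena, by induction on the number of edges ([certificate_exists]): if a
node u has two edges, remove either of them; if one of the two smaller
certificates makes the owner of u win from u, it is still a certificate;
otherwise both have the same region ([certificate_regions]), and following at
each node the better of the two potentials, normalised to 1 at u, gives a
certificate ([certificate_mix]). Potentials take their values in the
lexicographic product of G and the integers, where every edge has weight 1 in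
the second factor: no cycle has value 1 there, so that the two players play
exactly symmetric roles although value 1 in G favours only one of them.

The free group of rank 2 is embedded in the matrices over Z[t] that are
congruent to 1 modulo t, by sending x_0 and x_1 to the two elementary matrices
with entry t ([free_mx_inj]). Multiplying a matrix by such matrices on both
sides does not change its nonzero coefficients of lowest degree, so the sign of
a difference, read off these coefficients, defines a bi-invariant order
([free_group_order]). *)

Local Notation letter := ('I_2 * bool)%type.
Local Notation value v alpha n := (val_word v (mkseq alpha n)).

(** * Totally ordered groups *)

Definition strict (T : Type) (le : rel T) : rel T := fun a b => ~~ le b a.

Definition directed (T : Type) (le : rel T) (up : bool) : rel T :=
  fun a b => if up then le a b else le b a.

Lemma strict_directed (T : Type) (le : rel T) up a b :
  strict (directed le up) a b = if up then strict le a b else strict le b a.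
Proof. by case: up. Qed.

Section OrderedGroup.
Variables (G : groupType) (le : rel G).

Lemma directed_group_order up :
  total_group_order le -> total_group_order (directed le up).
Proof.
case: up => // -[anti tr tot mono]; split=> /= [a b|b a c|a b|a b x y].
- by rewrite andbC => /anti.
- by move=> ba ca; apply: tr ba.
- exact: tot.
- exact: mono.
Qed.

Hypothesis leG : total_group_order le.

Lemma order_anti : antisymmetric le. Proof. by case: leG. Qed.
Lemma order_trans : transitive le. Proof. by case: leG. Qed.
Lemma order_total : total le. Proof. by case: leG. Qed.

Lemma order_mul x y a b : le a b -> le (x * a * y) (x * b * y).
Proof. by case: leG => _ _ _; apply. Qed.

Lemma order_mull x a b : le a b -> le (x * a) (x * b).
Proof. by move/(order_mul x 1); rewrite !mulg1. Qed.

Lemma order_refl a : le a a.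
Proof. by have := order_total a a; rewrite orbb. Qed.

Lemma strict_irr a : strict le a a = false.
Proof. by rewrite /strict order_refl. Qed.

Lemma strictW a b : strict le a b -> le a b.
Proof.
by rewrite /strict => /negPf nba; have := order_total a b; rewrite nba orbF.
Qed.

Lemma strict_le_trans b a c : strict le a b -> le b c -> strict le a c.
Proof. by move=> ab bc; apply: contra ab => /(order_trans bc). Qed.

Lemma strict_trans : transitive (strict le).
Proof. by move=> b a c ab /strictW; apply: strict_le_trans. Qed.

Lemma strictE a b : strict le a b = (a != b) && le a b.
Proof.
apply/idP/andP => [ab|[]].
  by split; [apply: contraTneq ab => ->; rewrite strict_irr | apply: strictW].
by move=> neq ab; apply: contra neq => ba; apply/eqP/order_anti/andP.
Qed.

Lemma strict_mull x a b : strict le a b -> strict le (x * a) (x * b).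
Proof. by apply: contra => /(order_mull x^-1); rewrite !mulKg. Qed.

Lemma strict_mulr y a b : strict le a b -> strict le (a * y) (b * y).
Proof. by apply: contra => /(order_mul 1 y^-1); rewrite !mul1g !mulgK. Qed.

Lemma strict_mulIg y a b : strict le (a * y) (b * y) -> strict le a b.
Proof. by move/(strict_mulr y^-1); rewrite !mulgK. Qed.

End OrderedGroup.

(** The group of pairs of an element of G and an elapsed time, ordered
lexicographically with the element of G first: the time breaks the ties that
cycles of value 1 in G would cause. *)
Section TimedGroup.
Variable G : groupType.

Definition timed : Type := (G * int)%type.
HB.instance Definition _ := Choice.on timed.

Definition timed_mul (p q : timed) : timed := (p.1 * q.1, (p.2 + q.2)%R).
Definition timed_one : timed := (1, 0%R).
Definition timed_inv (p : timed) : timed := (p.1^-1, (- p.2)%R).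

Lemma timed_mulA : associative timed_mul.
Proof. by move=> p q r; rewrite /timed_mul /= mulgA GRing.addrA. Qed.
Lemma timed_mul1 : left_id timed_one timed_mul.
Proof. by case=> g n; rewrite /timed_mul /= mul1g GRing.add0r. Qed.
Lemma timed_mulr1 : right_id timed_one timed_mul.
Proof. by case=> g n; rewrite /timed_mul /= mulg1 GRing.addr0. Qed.
Lemma timed_mulV : left_inverse timed_one timed_inv timed_mul.
Proof. by move=> p; rewrite /timed_mul /= mulVg GRing.addNr. Qed.
Lemma timed_mulrV : right_inverse timed_one timed_inv timed_mul.
Proof. by move=> p; rewrite /timed_mul /= mulgV GRing.addrN. Qed.

HB.instance Definition _ := isGroup.Build timed
  timed_mulA timed_mul1 timed_mulr1 timed_mulV timed_mulrV.

Variable le : rel G.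
Hypothesis leG : total_group_order le.

Definition timed_le : rel timed :=
  fun p q => le p.1 q.1 && ((p.1 == q.1) ==> (p.2 <= q.2)%R).

Lemma strict_timed (p q : timed) : strict timed_le p q =
  strict le p.1 q.1 || (p.1 == q.1) && (p.2 < q.2)%R.
Proof.
rewrite /strict /timed_le negb_and negb_imply -Order.TotalTheory.ltNge.
by rewrite eq_sym.
Qed.

Lemma timed_group_order : total_group_order timed_le.
Proof.
split=> [[g m] [h n]|[h n] [g m] [k p]|[g m] [h n]|[g m] [h n] [x i] [y j]];
  rewrite /timed_le /=.
- case/andP=> /andP[gh imp1] /andP[hg imp2].
  have eq_gh : g = h by apply: (order_anti leG); rewrite gh hg.
  by move: imp1 imp2; rewrite eq_gh eqxx /= => mn nm; congr (_, _); lia.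
- case/andP=> gh imp1 /andP[hk imp2]; rewrite (order_trans leG gh hk) /=.
  apply/implyP=> /eqP eq_gk; subst k.
  have eq_gh : g = h by apply: (order_anti leG); rewrite gh hk.
  by move: imp1 imp2; rewrite eq_gh eqxx /=; lia.
- case: (eqVneq g h) => [->|_]; first by rewrite (order_refl leG) /=; lia.
  by rewrite !andbT; apply: order_total leG _ _.
- case/andP=> gh imp; rewrite (order_mul leG) //=.
  apply/implyP=> /eqP /mulIg /mulgI eq_gh.
  by move: imp; rewrite eq_gh eqxx /=; lia.
Qed.

End TimedGroup.

(** * Potential certificates *)

Lemma no_infinite_ascent (T : finType) (r : rel T) (D : {pred T}) :
    irreflexive r -> transitive r ->
    (forall v, v \in D -> exists2 t, t \in D & r v t) ->
  D =i pred0.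
Proof.
move=> irr tr step v; apply/negP => vD.
have [n] := ubnP #|[pred t | r v t]|; elim: n v vD => // n IHn v vD lt_n.
have [t tD vt] := step v vD; apply: IHn tD _.
apply: leq_trans (proper_card _) lt_n; apply/properP; split.
  by apply/fintype.subsetP=> z; rewrite !inE => /(tr _ _ _ vt).
by exists t; rewrite !inE ?irr ?vt.
Qed.

Section Certificates.
Variables (H : groupType) (le : rel H).
Hypothesis leH : total_group_order le.
Variables (V D : finType) (src tgt : D -> V) (wt : D -> H) (own : V -> bool).

Definition choice_in (E : {set D}) (ch : V -> D) : Prop :=
  forall v, ch v \in E /\ src (ch v) = v.

Definition monotone_along (R : {set V}) (a : V -> H) (e : D) : Prop :=
  (tgt e \in R) = (src e \in R) /\
  strict (directed le (src e \in R)) (a (src e)) (wt e * a (tgt e)).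

(** The nodes v with [own v = true] belong to the player who wants potentials
to rise, so R is the region where this player wins, and [own v = (v \in R)] says
that the owner of v wins from v: only there is the choice [ch v] imposed. Since
all conditions are local, a certificate can be transferred between graphs edge
by edge. *)
Definition certificate (E : {set D}) (R : {set V}) (ch : V -> D)
    (a : V -> H) : Prop :=
  choice_in E ch /\
  forall e, e \in E -> (own (src e) = (src e \in R) -> e = ch (src e)) ->
    monotone_along R a e.

Lemma certificate_shift E R ch a g :
  certificate E R ch a -> certificate E R ch (fun v => a v * g).
Proof.
case=> chE cert; split=> // e eE che; have [tR lt] := cert e eE che.
split=> //; rewrite mulgA.
by apply: strict_mulr lt; apply: directed_group_order.
Qed.

(** A player who wins from the source of e0 can ignore the additional option
e0. *)
Lemma certificate_widen E e0 (R : {set V}) ch a :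
    own (src e0) = (src e0 \in R) -> certificate (E :\ e0) R ch a ->
  certificate E R ch a.
Proof.
move=> own_u [chE cert]; split=> [v|e eE che].
  by have [/setD1P[_ chvE] ?] := chE v.
have [ee0|ne0] := eqVneq e e0; last by apply: cert => //; rewrite !inE ne0.
apply: (cert _ _ che); rewrite che ?ee0 //.
by have [] := chE (src e0).
Qed.

(** On a node where the two regions disagree, the two certificates impose
choices on opposite owners, hence some edge is monotone for both. The quotient
of the two potentials is strictly monotone along it, and it leads to another
such node: this cannot go on forever in a finite graph. *)
Lemma certificate_regions u (E1 E2 : {set D}) (R1 R2 : {set V}) ch1 ch2 a1 a2 :
    (forall e, src e != u -> (e \in E1) = (e \in E2)) ->
    own u != (u \in R1) -> own u != (u \in R2) ->
    certificate E1 R1 ch1 a1 -> certificate E2 R2 ch2 a2 ->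
  R1 = R2.
Proof.
move=> eqE uR1 uR2 [chE1 cert1] [chE2 cert2].
suff main c : [pred v | (v \in R1) == c & (v \in R2) == ~~ c] =i pred0.
  apply/setP=> v; have := main (v \in R1) v; rewrite !inE eqxx /=.
  by case: (v \in R1); case: (v \in R2).
pose r v t := strict (directed le (~~ c)) ((a1 v)^-1 * a2 v) ((a1 t)^-1 * a2 t).
have leHd := directed_group_order (~~ c) leH.
apply: (@no_infinite_ascent _ r) => [v|t v z|v]; first exact: strict_irr.
  exact: strict_trans.
rewrite inE => /andP[/eqP vR1 /eqP vR2].
have neq_vu : v != u.
  apply/eqP=> eq_vu; move: uR1 uR2; rewrite -eq_vu vR1 vR2.
  by case: (own v); case: c {r leHd vR1 vR2}.
(* The choice of the certificate in which the owner of v wins is also an edge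
   for the other certificate, which constrains every edge from v. *)
have [e [e1 e2 src_e che1 che2]] : exists e, [/\ e \in E1, e \in E2, src e = v,
    own v = c -> e = ch1 v & own v = ~~ c -> e = ch2 v].
  case: (eqVneq (own v) c) => own_v; [exists (ch1 v)|exists (ch2 v)].
    have [? src_v] := chE1 v; split=> //; first by rewrite -eqE ?src_v.
    by rewrite own_v; case: (c).
  have [? src_v] := chE2 v; split=> //; first by rewrite eqE ?src_v.
  by move/eqP; rewrite (negPf own_v).
have [tR1 lt1] : monotone_along R1 a1 e by apply: cert1; rewrite ?src_e ?vR1.
have [tR2 lt2] : monotone_along R2 a2 e by apply: cert2; rewrite ?src_e ?vR2.
rewrite src_e vR1 in tR1 lt1; rewrite src_e vR2 in tR2 lt2.
exists (tgt e); first by rewrite inE tR1 tR2 !eqxx.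
have lt1' : strict (directed le (~~ c)) (wt e * a1 (tgt e)) (a1 v).
  by move: lt1; case: (c).
have/(strict_mull leHd (a1 v)^-1) lt2' := lt2.
apply: strict_trans lt2' _ => //.
have /(strict_mull leHd (a1 v)^-1) := lt1'.
move=> /(strict_mulr leHd ((a1 (tgt e))^-1 * a2 (tgt e))).
by rewrite mulVg mul1g !mulgA mulgK.
Qed.

(** The loser at u may alternate between e1 and e2 while the winner has one
choice function for each. Once both potentials are 1 at u, the winner can
follow at each node the certificate with the better potential: the inequality
for the followed potential implies the one for the best potential, and at u
both potentials agree. *)
Lemma certificate_mix u e1 e2 (E : {set D}) (R : {set V}) ch1 ch2 a1 a2 :
    src e1 = u -> src e2 = u -> e1 != e2 -> own u != (u \in R) ->
    certificate (E :\ e1) R ch1 a1 -> certificate (E :\ e2) R ch2 a2 ->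
  exists ch a, certificate E R ch a.
Proof.
move=> src1 src2 neq12 uR.
move=> /(certificate_shift (a1 u)^-1) + /(certificate_shift (a2 u)^-1).
set b1 := fun v => a1 v * _; set b2 := fun v => a2 v * _.
move=> [chE1 cert1] [chE2 cert2].
pose c := ~~ own u; have uRc : (u \in R) = c.
  by rewrite /c; move: uR; case: (own u); case: (u \in R).
have leHc := directed_group_order c leH.
(* Outside the winner's region no choice is at stake and the first certificate
   is kept as it is. *)
pose one v := ((v \in R) != c) || directed le c (b2 v) (b1 v).
pose a v := if one v then b1 v else b2 v.
exists (fun v => if one v then ch1 v else ch2 v), a.
split=> [v|e eE che].
  have [/setD1P[_ ?] ?] := chE1 v; have [/setD1P[_ ?] ?] := chE2 v.
  by case: ifP.
have [vR|vR] := eqVneq (src e \in R) c; last first.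
  have neq_u : src e != u by apply: contraNneq vR => ->; apply/eqP.
  have one_v : one (src e) by rewrite /one vR.
  have [tR lt] : monotone_along R b1 e.
    apply: cert1 => [|/che]; last by rewrite one_v.
    by rewrite !inE eE andbT; apply: contraNneq neq_u => ->; apply/eqP.
  by split=> //; rewrite /a one_v /one tR vR.
have a_ge1 t : (t \in R) = c -> directed le c (b1 t) (a t).
  move=> tR; rewrite /a /one tR eqxx /=.
  case: ifP => [_|/negbT]; first exact: order_refl.
  exact: strictW.
have a_ge2 t : (t \in R) = c -> directed le c (b2 t) (a t).
  move=> tR; rewrite /a /one tR eqxx /=.
  by case: ifP => // _; apply: order_refl.
have lift b : a (src e) = b (src e) ->
    (forall t, (t \in R) = c -> directed le c (b t) (a t)) ->
    monotone_along R b e -> monotone_along R a e.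
  move=> a_src a_ge [tR lt]; split=> //; rewrite a_src.
  move: lt; rewrite vR => lt; apply: strict_le_trans lt _ => //.
  by apply: order_mull => //; apply: a_ge; rewrite tR.
have bu : (b1 u = 1) * (b2 u = 1) by rewrite /b1 /b2 !mulgV.
have [src_u|neq_u] := eqVneq (src e) u.
  have au : a u = 1 by rewrite /a !bu if_same.
  have own_e : own (src e) = (src e \in R) -> False.
    by rewrite src_u => /eqP; rewrite (negPf uR).
  have [ee1|ne1] := eqVneq e e1.
    apply: (lift b2) => //; first by rewrite src_u au bu.
    by apply: cert2; rewrite // !inE eE andbT ee1.
  apply: (lift b1) => //; first by rewrite src_u au bu.
  by apply: cert1; rewrite // !inE eE andbT.
have ne1 : e != e1 by apply: contraNneq neq_u => ->; apply/eqP.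
have ne2 : e != e2 by apply: contraNneq neq_u => ->; apply/eqP.
case one_v : (one (src e)); [apply: (lift b1) | apply: (lift b2)] => //.
- by rewrite /a one_v.
- by apply: cert1 => [|/che]; rewrite ?one_v // !inE ne1.
- by rewrite /a one_v.
- by apply: cert2 => [|/che]; rewrite ?one_v // !inE ne2.
Qed.

End Certificates.

Section Determinacy.
Variables (G : groupType) (le : rel G).
Hypothesis leG : total_group_order le.
Variables (V D : finType) (src tgt : D -> V) (wt : D -> G) (own : V -> bool).

Definition timed_weight (e : D) : timed G := (wt e, 1%R).

(** When every node has a single outgoing edge, the play from v ends in a cycle,
and v lies in R when the value of this cycle is at least 1. With a root chosen
on each cycle, the potential of v is the value of its path to the root: it is
balanced along every edge except at the root, where the value of the cycle
decides. The time component breaks the ties. *)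
Lemma certificate_deterministic E ch :
    choice_in src E ch -> (forall e, e \in E -> e = ch (src e)) ->
  exists R a,
    certificate (timed_le le) src tgt timed_weight own E R ch a.
Proof.
move=> chE chP; pose f v := tgt (ch v); pose w v := wt (ch v).
pose root v := odflt v [pick x | fconnect f (f x) x && fconnect f v x].
have rootP v : fconnect f (f (root v)) (root v) && fconnect f v (root v).
  rewrite /root; case: pickP => //= none.
  have /trajectP[i lt_i eq_i] := looping_order f v.
  have := none (iter i f v); rewrite fconnect_iter andbT.
  suff {2}<- : iter (order f v - i.+1) f (f (iter i f v)) = iter i f v.
    by rewrite fconnect_iter.
  by rewrite -iterS -iterD subnK.
(* A node and its successor reach the same nodes on cycles, and the result of
   the pick depends only on that set. *)
have root_f v : root (f v) = root v.
  rewrite /root.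
  have /eq_pick -> : (fun x => fconnect f (f x) x && fconnect f (f v) x)
      =1 (fun x => fconnect f (f x) x && fconnect f v x).
    move=> x; case: (boolP (fconnect f (f x) x)) => //= fx.
    rewrite [in RHS]fconnect_eqVf; case: eqVneq => //= eq_vx.
    by rewrite eq_vx fx.
  case: pickP => //= none; have := rootP v; rewrite /root.
  by case: pickP => //= _ /[!none].
pose dist v := findex f v (root v).
pose disp v := \prod_(i < dist v) w (iter i f v).
have dist_step v : v != root v -> dist v = (dist (f v)).+1.
  move=> vr; rewrite /dist root_f fconnect_findex // 1?eq_sym //.
  by have /andP[] := rootP v.
have disp_step v : v != root v -> disp v = w v * disp (f v).
  move=> vr; rewrite /disp dist_step // big_ord_recl /=; congr (_ * _).
  by apply: eq_bigr => i _; rewrite -iterSr.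
have root0 v : v = root v -> (dist v = 0%N) * (disp v = 1).
  by move=> vr; rewrite /disp /dist -vr findex0 big_ord0.
pose R := [set v | le 1 (w (root v) * disp (f (root v)))].
(* Every edge takes one unit of time, so a constant time rises along it, while
   a time that decreases by two falls. *)
exists R, (fun v => (disp v, if v \in R then 0%R else (Posz (dist v).*2))).
split=> // e eE _; rewrite /monotone_along (chP e eE).
move: (src e) => v; have [_ ->] := chE v.
have tR : (f v \in R) = (v \in R) by rewrite !inE root_f.
split=> //; rewrite -/(f v) tR /timed_weight -/(w v).
have [vr|vr] := eqVneq v (root v); last first.
  case: (v \in R);
    rewrite strict_directed /= strict_timed (disp_step v) ?eqxx //=.
    by apply/orP; right.
  apply/orP; right; rewrite (dist_step v) //.
  by lia.
have Rv : (v \in R) = le 1 (w v * disp (f v)) by rewrite inE -vr.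
rewrite (root0 v vr).2 (root0 v vr).1.
case vR: (v \in R); rewrite strict_directed /= strict_timed //=.
  apply/orP; case: (eqVneq 1 (w v * disp (f v))) => neq; [right|left].
    by [].
  by rewrite strictE // neq -Rv.
by rewrite /strict -Rv vR.
Qed.

(** This is positional determinacy for both players at once; the induction
removes edges at a node with at least two. *)
Lemma certificate_exists (E : {set D}) :
    (forall v, exists2 e, e \in E & src e = v) ->
  exists R ch a, certificate (timed_le le) src tgt timed_weight own E R ch a.
Proof.
have leH := timed_group_order leG.
have [n] := ubnP #|E|; elim: n E => // n IHn E ltE total_E.
have [/exists_inP[e1 e1E /exists_inP[e2 e2E /andP[/eqP src12 neq12]]]|] :=
  boolP [exists e1 in E, exists e2 in E, (src e1 == src e2) && (e1 != e2)];
  last first.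
  move=> /exists_inPn uniqE.
  have /choice[ch chE] : forall v, exists e, e \in E /\ src e = v.
    by move=> v; have [e] := total_E v; exists e.
  suff [R [a cert]] : exists R a,
      certificate (timed_le le) src tgt timed_weight own E R ch a.
    by exists R, ch, a.
  apply: certificate_deterministic => // e eE; apply/eqP.
  have [chv src_v] := chE (src e).
  by have /exists_inPn/(_ _ chv) := uniqE e eE; rewrite src_v eqxx negbK.
have smaller e e' : e \in E -> e' \in E -> e != e' -> src e = src e' ->
  exists R ch a,
    certificate (timed_le le) src tgt timed_weight own (E :\ e) R ch a.
  move=> eE e'E neq src_e; apply: IHn => [|v].
    by rewrite [#|E|](cardsD1 e) eE in ltE.
  have [d dE src_d] := total_E v; have [ed|] := eqVneq d e; last first.
    by exists d; rewrite // !inE dE andbT.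
  by exists e'; rewrite -?src_e -?ed // !inE ed eq_sym neq.
have [R1 [ch1 [a1 cert1]]] := smaller _ _ e1E e2E neq12 src12.
have := smaller _ _ e2E e1E; rewrite eq_sym => /(_ neq12 (esym src12)).
move=> [R2 [ch2 [a2 cert2]]].
have [own1|own1] := eqVneq (own (src e1)) (src e1 \in R1).
  by exists R1, ch1, a1; apply: certificate_widen own1 cert1.
have [own2|own2] := eqVneq (own (src e2)) (src e2 \in R2).
  by exists R2, ch2, a2; apply: certificate_widen own2 cert2.
rewrite -src12 in own2.
have eqR : R1 = R2.
  apply: (certificate_regions leH _ own1 own2 cert1 cert2) => e neq_e.
  rewrite !inE; have [ee1|_] := eqVneq e e1; first by rewrite ee1 eqxx in neq_e.
  by have [ee2|//] := eqVneq e e2; rewrite ee2 src12 eqxx in neq_e.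
rewrite -eqR in cert2; exists R1.
exact: (certificate_mix leH erefl (esym src12) neq12 own1 cert1 cert2).
Qed.

End Determinacy.

(** * Energy games *)

(** Dependent choice along increasing indices: the common tool for extracting
subsequences. *)
Lemma increasing_extraction (P : nat -> Prop) (r : nat -> nat -> Prop) n0 :
    P n0 -> (forall n, P n -> exists m, [/\ n < m, P m & r n m]) ->
  exists phi : nat -> nat,
    [/\ {homo phi : i j / i < j}, forall k, P (phi k)
      & forall k, r (phi k) (phi k.+1)].
Proof.
move=> Pn0 step.
have /choice[next nextP] n : exists m, P n -> [/\ n < m, P m & r n m].
  by have [/step[m]|] := pselect (P n); [exists m | exists n].
have Pphi k : P (iter k next n0) by elim: k => //= k /nextP[].
exists (fun k => iter k next n0).
split=> // [|k]; last by have [] := nextP _ (Pphi k).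
apply: homo_ltn => [|k]; first exact: ltn_trans.
by have [] := nextP _ (Pphi k).
Qed.

Lemma infinitely_often (T : finType) (f : nat -> T) :
  exists x, forall n, exists m, n < m /\ f m = x.
Proof.
apply: contrapT => /forallNP none.
have /choice[b bP] x : exists n, forall m, n < m -> f m <> x.
  have /existsNP[n nP] := none x; exists n => m lt_nm eq_x.
  by apply: nP; exists m.
apply: (bP _ (\max_x b x).+1 _ erefl).
by rewrite ltnS leq_bigmax.
Qed.

Section EnergyGames.
Variables (G : groupType) (le : rel G) (C : finType) (v : C -> G).
Hypothesis leG : total_group_order le.

Lemma valueS (alpha : nat -> C) n :
  value v alpha n.+1 = value v alpha n * v (alpha n).
Proof. by rewrite /val_word mkseqS big_rcons. Qed.

Lemma energyP (alpha : nat -> C) :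
  energy_condition le v alpha <->
  exists phi : nat -> nat, {homo phi : i j / i < j} /\
    forall k,
      strict le (value v alpha (phi k.+1).+1) (value v alpha (phi k).+1).
Proof.
split=> -[phi [phi_incr decr]]; exists phi; split=> // k.
  by have [ge_k /eqP neq_k] := decr k; rewrite strictE // neq_k.
by have := decr k; rewrite strictE // => /andP[/eqP].
Qed.

Lemma value_prepend x (alpha : nat -> C) n :
  value v (prepend x alpha) (size x + n) = val_word v x * value v alpha n.
Proof.
rewrite /val_word -big_cat; congr (\prod_(c <- _) _).
apply: (@eq_from_nth _ (alpha 0)); first by rewrite size_cat !size_mkseq.
move=> i; rewrite size_mkseq => lt_i.
rewrite nth_mkseq // nth_cat /prepend; case: ltnP => lt_ix.
  exact: set_nth_default.
by rewrite nth_default // nth_mkseq //; lia.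
Qed.

Lemma energy_prefix_independent : prefix_independent (energy_condition le v).
Proof.
move=> x alpha; split=> /energyP[phi [phi_incr decr]]; apply/energyP.
  exists (fun k => size x + phi k); split=> [i j lt_ij|k].
    by rewrite ltn_add2l phi_incr.
  by rewrite -!addnS !value_prepend; apply: strict_mull.
have phi_ge k : k <= phi k.
  by elim: k => // k IHk; apply: leq_ltn_trans IHk (phi_incr _ _ _).
exists (fun k => phi (size x + k) - size x); split=> [i j lt_ij|k].
  rewrite ltn_sub2rE; first by rewrite phi_incr ?ltn_add2l.
  by apply: leq_trans (phi_ge _); rewrite leq_addr.
have shift i : size x <= phi (size x + i).
  by apply: leq_trans (phi_ge _); rewrite leq_addr.
have := decr (size x + k).
have shiftE i : value v (prepend x alpha) (phi (size x + i)).+1 =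
    val_word v x * value v alpha (phi (size x + i) - size x).+1.
  by rewrite -value_prepend addnS subnKC.
rewrite -addnS !shiftE => /(strict_mull leG (val_word v x)^-1).
by rewrite !mulKg.
Qed.

Section Plays.
Variables (A : arena C) (own : node A -> bool).
Variables (R : {set node A}) (ch : node A -> edge A) (a : node A -> timed G).
Hypothesis cert : certificate (timed_le le) (@source C A) (@target C A)
  (timed_weight (fun e : edge A => v (col e))) own [set: edge A] R ch a.

Variables (pi : nat -> edge A) (up : bool).
Hypothesis pi_path : forall n, source (pi n.+1) = target (pi n).
Hypothesis pi_start : (source (pi 0) \in R) = up.
Hypothesis pi_choice :
  forall n, own (source (pi n)) = up -> pi n = ch (source (pi n)).

(** The product of the value of the prefix and the potential of the current
node is strictly monotone along the play, and the potential cancels between two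
visits to the same node. The elapsed time turns the strict rise in the timed
group into a weak one in G, and the strict fall into a strict one. *)
Lemma value_revisit i j : i < j -> source (pi i) = source (pi j) ->
  if up then le (value v (@col C A \o pi) i) (value v (@col C A \o pi) j)
  else strict le (value v (@col C A \o pi) j) (value v (@col C A \o pi) i).
Proof.
have leH := timed_group_order leG; have leU := directed_group_order up leH.
have [_ edge_mono] := cert.
have step n : (source (pi n) \in R) = up -> monotone_along (timed_le le)
    (@source C A) (@target C A) (timed_weight (fun e => v (col e))) R a (pi n).
  by move=> nR; apply: edge_mono; [rewrite inE | rewrite nR => /pi_choice].
have stay n : (source (pi n) \in R) = up.
  elim: n => // n IHn; have [tR _] := step n IHn.
  by rewrite pi_path tR.
pose pot n : timed G := (value v (@col C A \o pi) n, Posz n).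
have pot_incr : {homo (fun n => pot n * a (source (pi n))) : i j / i < j >->
    strict (directed (timed_le le) up) i j}.
  apply: (homo_ltn (r := strict (directed (timed_le le) up))) => [y x z|n].
    exact: strict_trans.
  have [_] := step n (stay n); rewrite stay => /(strict_mull leU (pot n)).
  rewrite pi_path mulgA; congr (strict _ _ (_ * _)).
  by rewrite /pot valueS; congr (_, _); rewrite /=; lia.
move=> lt_ij eq_src; have := pot_incr i j lt_ij.
rewrite eq_src => /(strict_mulIg leU); rewrite strict_directed.
case: (up) => /=; rewrite strict_timed /=.
  case/orP => [|/andP[/eqP-> _]]; last exact: order_refl.
  exact: strictW.
by case/orP=> // /andP[_]; lia.
Qed.

(** If the potential rises, a decreasing subsequence would contain two visits to
the same node in the wrong order; if it falls, the values at some node visited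
infinitely often decrease. *)
Lemma energy_play : energy_condition le v (@col C A \o pi) <-> up = false.
Proof.
split=> [/energyP[phi [phi_incr decr]]|up_false]; last first.
  have [x often] := infinitely_often (fun n => source (pi n)).
  have [n0 [_ src0]] := often 0.
  have [|psi [psi_incr src_psi _]] := @increasing_extraction
      (fun n => source (pi n) = x) (fun _ _ => True) n0 src0.
    by move=> n _; have [m []] := often n; exists m.
  apply/energyP; exists (fun k => (psi k.+1).-1).
  have psi_gt0 k : 0 < psi k.+1 by apply: leq_ltn_trans (psi_incr k k.+1 _).
  split=> [i j lt_ij|k].
    by have := psi_incr i.+1 j.+1 lt_ij; have := psi_gt0 i; lia.
  rewrite !prednK //; have := @value_revisit (psi k.+1) (psi k.+2).
  by rewrite up_false; apply; rewrite ?src_psi //; apply: psi_incr.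
apply/negbTE/negP=> up_true.
pose nodes (i : 'I_#|node A|.+1) := source (pi (phi i).+1).
have /injectivePn[i [j neq_ij eq_ij]] : ~~ injectiveb nodes.
  apply/negP=> /injectiveP/leq_card; rewrite card_ord; lia.
wlog lt_ij : i j neq_ij eq_ij / i < j.
  move=> wl; have [|lt_ji|/val_inj] := ltngtP i j; first exact: wl.
    by apply: (wl j i) => //; rewrite eq_sym.
  by move/eqP; rewrite (negPf neq_ij).
have : strict le (value v (@col C A \o pi) (phi j).+1)
    (value v (@col C A \o pi) (phi i).+1).
  apply: (homo_ltn (f := fun k => value v (@col C A \o pi) (phi k).+1)
    (r := fun x y => strict le y x)) => //.
  by move=> y x z yx zy; apply: strict_trans zy yx.
have := @value_revisit (phi i).+1 (phi j).+1; rewrite up_true ltnS.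
by move=> /(_ (phi_incr _ _ lt_ij) eq_ij) le_ij; rewrite /strict le_ij.
Qed.

End Plays.

Lemma edges_from (A : arena C) (s : node A) :
  exists2 e : edge A, e \in [set: edge A] & source e = s.
Proof.
have [c [t stE]] := edges_total s.
by exists (exist _ (s, c, t) stE); rewrite ?inE.
Qed.

(** The parameter [up] says which player wants potentials to rise, that is,
wants the energy condition to fail; both assignments are needed, since
bi-positionality also concerns the complement. *)
Lemma positional_win (A : arena C) (up : player -> bool) : up Alice != up Bob ->
  exists (sigma : forall P, positional_strategy A P), forall s, exists P,
    forall pi, play_from s pi ->
      consistent (strategy_of_positional (sigma P)) pi ->
    energy_condition le v (@col C A \o pi) <-> up P = false.
Proof.
move=> upAB; pose own (s : node A) := if s is inl _ then up Alice else up Bob.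
have [R [ch [a cert]]] := certificate_exists leG (@target C A)
  (fun e => v (col e)) own (@edges_from A).
have src_ch s : source (ch s) = s by case: cert => chE _; case: (chE s).
exists (fun P =>
  PositionalStrategy (fun u : owned A P => src_ch (owned_node u))).
move=> s; have [P PR] : exists P, up P = (s \in R).
  have [|neq] := eqVneq (up Alice) (s \in R); first by exists Alice.
  exists Bob; move: upAB neq.
  by case: (up Alice); case: (up Bob); case: (s \in R).
exists P => pi [src0 path_pi] cons.
apply: (energy_play cert path_pi); first by rewrite src0.
move=> n own_n.
have [u src_u] : exists u : owned A P, source (pi n) = owned_node u.
  move: own_n upAB; rewrite /own.
  case: P {PR cons} => /=; case: (source (pi n)) => u; try by exists u.
    by move=> -> /eqP.
  by move=> -> /eqP.
by rewrite [LHS](cons n u src_u) /= src_u.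
Qed.

Lemma energy_bi_positional : bi_positional (energy_condition le v).
Proof.
split=> A.
  have [//|sigma win] := @positional_win A
    (fun P => if P is Bob then true else false).
  exists (sigma Alice) => s not_win.
  exists (strategy_of_positional (sigma Bob)).
  have [[] winP] := win s.
    by case: not_win => pi play cons; apply/(winP pi play cons).
  by move=> pi play cons /(winP pi play cons).
have [//|sigma win] := @positional_win A
  (fun P => if P is Alice then true else false).
exists (sigma Alice) => s not_win; exists (strategy_of_positional (sigma Bob)).
have [[] winP] := win s.
  by case: not_win => pi play cons /(winP pi play cons).
by move=> pi play cons; rewrite /objective setCK; apply/(winP pi play cons).
Qed.

End EnergyGames.

(** * An order on the free group of rank two *)

Section FreeGroupOrder.
Import GRing.Theory Num.Theory Order.POrderTheory.
Local Open Scope ring_scope.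

Definition letter_sign (l : letter) : int := (-1) ^+ (~~ l.2).

(** The elementary matrix with the entry t or -t off the diagonal, in the row
given by the generator. *)
Definition letter_mx (l : letter) : 'M[{poly int}]_2 :=
  1%:M + (letter_sign l *: 'X) *: delta_mx l.1 (rev_ord l.1).

Definition word_mx (w : seq letter) : 'M[{poly int}]_2 :=
  foldr (fun l M => letter_mx l *m M) 1%:M w.

Definition free_mx (g : free_group 'I_2) := word_mx (letters g).

Lemma rev_ord_neq (i : 'I_2) : rev_ord i != i.
Proof. by rewrite -val_eqE /=; case: i => -[|[]]. Qed.

Lemma letter_mxV l : letter_mx l *m letter_mx (inv_letter l) = 1%:M.
Proof.
rewrite /letter_mx /letter_sign /= mulmxDl mul1mx mulmxDr mulmx1.
rewrite -scalemxAl -scalemxAr mul_delta_mx_0 ?rev_ord_neq // !scaler0 addr0.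
rewrite -addrA -scalerDl -scalerDl.
by case: l.2; rewrite /= ?expr1 ?expr0 ?addNr ?subrr scale0r scale0r addr0.
Qed.

Lemma word_mx_push l w : word_mx (push_letter l w) = letter_mx l *m word_mx w.
Proof.
case: w => //= l' w; case: eqP => //= ->.
by rewrite mulmxA letter_mxV mul1mx.
Qed.

Lemma free_mxM g h : free_mx (g * h)%g = free_mx g *m free_mx h.
Proof.
rewrite /free_mx /=.
elim: (letters g) => [|l w IHw] /=; first by rewrite mul1mx.
by rewrite word_mx_push IHw mulmxA.
Qed.

(** The image of the column vector (1, 1). *)
Definition word_vec (w : seq letter) (i : 'I_2) : {poly int} :=
  (word_mx w *m const_mx 1) i (@ord0 0).

Lemma word_vec_cons l w i : word_vec (l :: w) i =
  word_vec w i +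
    (i == l.1)%:R *: (letter_sign l *: (word_vec w (rev_ord i) * 'X)).
Proof.
rewrite /word_vec /= -mulmxA; move: (word_mx w *m _) => u.
rewrite /letter_mx mulmxDl mul1mx mxE -scalemxAl mxE; congr (_ + _).
have [->|neq_i] := eqVneq i l.1.
  rewrite scale1r mxE (bigD1 (rev_ord l.1)) //= big1 ?addr0 => [|j neq_j].
    by rewrite mxE !eqxx mul1r -scalerAl mulrC.
  by rewrite mxE (negPf neq_j) andbF mul0r.
rewrite scale0r mxE big1 ?mulr0 // => j _.
by rewrite mxE (negPf neq_i) mul0r.
Qed.

Lemma size_dominant (p q : {poly int}) (c : int) :
    q != 0 -> c != 0 -> (size p <= size q)%N ->
  size (p + c *: (q * 'X)) = (size q).+1.
Proof.
move=> q0 c0 le_pq; have sizeX : size (c *: (q * 'X)) = (size q).+1.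
  by rewrite size_scale // size_mulX.
by rewrite addrC size_polyDl sizeX.
Qed.

(** A ping-pong argument on degrees: reading a reduced word from right to left,
the coordinate of the last letter read has degree one more than the other one.
A repeated letter only adds to the multiple of t times the other coordinate,
which never cancels because the word is reduced; a change of generator
exchanges the roles of the coordinates. *)
Lemma word_vec_dominant l w : reduced (l :: w) ->
  exists (p : {poly int}) (n : nat),
    [/\ word_vec (l :: w) (rev_ord l.1) != 0,
        (size p <= size (word_vec (l :: w) (rev_ord l.1)))%N
      & word_vec (l :: w) l.1 = p + (letter_sign l *+ n.+1) *:
          (word_vec (l :: w) (rev_ord l.1) * 'X)].
Proof.
have nil_vec i : word_vec [::] i = 1.
  by rewrite /word_vec mul1mx mxE.
have sign_neq0 l' n : letter_sign l' *+ n.+1 != 0.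
  by rewrite mulrn_eq0 /letter_sign signr_eq0.
elim: w l => [|l' w IHw] l red.
  exists 1, 0%N; rewrite !word_vec_cons !nil_vec (negPf (rev_ord_neq _)).
  rewrite scale0r addr0.
  by rewrite eqxx scale1r mulr1n oner_eq0.
case/andP: red => neq_l' /IHw[p [n [q0 size_p vec_l']]].
have same :
    word_vec [:: l, l' & w] (rev_ord l.1) = word_vec (l' :: w) (rev_ord l.1).
  by rewrite [LHS]word_vec_cons (negPf (rev_ord_neq _)) scale0r addr0.
have vec_l : word_vec [:: l, l' & w] l.1 = word_vec (l' :: w) l.1 +
    letter_sign l *: (word_vec (l' :: w) (rev_ord l.1) * 'X).
  by rewrite [LHS]word_vec_cons eqxx scale1r.
rewrite same vec_l; have [eq1|neq1] := eqVneq l'.1 l.1.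
  have eq_l : l' = l.
    move: neq_l' eq1; case: (l) => x b; case: (l') => y c /= neq eq_yx.
    move: neq; rewrite eq_yx /inv_letter /= xpair_eqE eqxx /=.
    by case: b; case: c.
  rewrite eq_l in vec_l' q0 size_p *; exists p, n.+1; split=> //.
  by rewrite vec_l' -addrA -scalerDl -mulrSr.
have eq1 : l'.1 = rev_ord l.1.
  apply: val_inj; move: neq1; rewrite -val_eqE /=.
  by case: (l'.1) => m lt_m; case: (l.1) => n' lt_n' /=; lia.
rewrite -eq1; rewrite eq1 rev_ordK -eq1 in vec_l' q0 size_p.
have size_l' := size_dominant q0 (sign_neq0 _ _) size_p.
exists (word_vec (l' :: w) l.1), 0%N; split=> //.
- by rewrite -size_poly_eq0 vec_l' size_l'.
- by rewrite [in leqRHS]vec_l' size_l' leqW.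
Qed.

Lemma free_mx_eq1 g : free_mx g = 1%:M -> g = 1%g.
Proof.
move=> g1; apply: val_inj => /=; case: g g1 => -[|l w] //= red.
rewrite /free_mx /= => w1; have [p [n [q0 size_p]]] := word_vec_dominant red.
have vec1 i : word_vec (l :: w) i = 1 by rewrite /word_vec /= w1 mul1mx mxE.
rewrite !vec1 in size_p * => /(congr1 (fun q : {poly int} => size q)).
rewrite size_dominant ?oner_eq0 //; first by rewrite size_poly1.
by rewrite mulrn_eq0 /letter_sign signr_eq0.
Qed.

Lemma free_mx_inj : injective free_mx.
Proof.
move=> g h eq_gh; apply/eqP; rewrite -divg_eq1; apply/eqP/free_mx_eq1.
by rewrite free_mxM eq_gh -free_mxM mulgV.
Qed.

Definition unipotent (M : 'M[{poly int}]_2) : Prop :=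
  forall i j, (M i j)`_0 = (i == j)%:R.

Lemma unipotentM M N : unipotent M -> unipotent N -> unipotent (M *m N).
Proof.
move=> uM uN i j; rewrite mxE coef_sum (bigD1 i) //= big1 => [|k neq_k].
  by rewrite addr0 coef0M uM uN eqxx mul1r.
by rewrite coef0M uM eq_sym (negPf neq_k) mul0r.
Qed.

Lemma unipotent_free_mx g : unipotent (free_mx g).
Proof.
rewrite /free_mx; elim: (letters g) => [|l w IHw] /=.
  by move=> i j; rewrite mxE coefMn coef1 /= natz.
apply: unipotentM IHw => i j; rewrite !mxE coefD coefMn coef1 /=.
by rewrite -scalerAl coefZ coefXM mulr0 addr0.
Qed.

Definition vanishes_below k (M : 'M[{poly int}]_2) : Prop :=
  forall n, (n < k)%N -> forall i j, (M i j)`_n = 0.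

Lemma unipotent_mulmx_coef k U M i j : unipotent U -> vanishes_below k M ->
  ((U *m M) i j)`_k = (M i j)`_k.
Proof.
move=> uU vM; have term h : (U i h * M h j)`_k = (U i h)`_0 * (M h j)`_k.
  rewrite coefM big_ord_recl subn0 big1 ?addr0 // => n _.
  by rewrite vM ?mulr0 //= /bump; have := ltn_ord n; lia.
rewrite mxE coef_sum (bigD1 i) //= term uU eqxx mul1r big1 ?addr0 // => h neq_h.
by rewrite term uU eq_sym (negPf neq_h) mul0r.
Qed.

Lemma vanishes_belowW k m M : (m <= k)%N ->
  vanishes_below k M -> vanishes_below m M.
Proof. by move=> le_mk vM n lt_nm; apply: vM; apply: leq_trans le_mk. Qed.

(** U and W are 1 in degree 0, so they affect M only in degrees above its lowest
one. *)
Lemma unipotent_sandwich_coef k U M W n i j :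
    unipotent U -> unipotent W -> vanishes_below k M -> (n <= k)%N ->
  ((U *m M *m W) i j)`_n = (M i j)`_n.
Proof.
move=> uU uW vM le_nk.
have vUM : vanishes_below k (U *m M).
  move=> m lt_mk a b; rewrite unipotent_mulmx_coef ?vM //.
  exact: vanishes_belowW (ltnW lt_mk) vM.
have -> : (U *m M *m W) i j = (W^T *m (U *m M)^T) j i.
  by rewrite -trmx_mul [RHS]mxE.
rewrite unipotent_mulmx_coef.
- by rewrite [in LHS]mxE unipotent_mulmx_coef //; apply: vanishes_belowW vM.
- by move=> a b; rewrite mxE uW eq_sym.
- by move=> m lt_mn a b; rewrite mxE vUM //; lia.
Qed.

(** All coefficients of a 2 x 2 matrix over Z[t] in one sequence, degree by
degree, with four entries for each degree. *)
Definition mx_coefs (M : 'M[{poly int}]_2) (n : nat) : int :=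
  (M (inord (n %% 4 %/ 2)) (inord (n %% 2)))`_(n %/ 4).

(** Positivity for the lexicographic order on integer sequences. *)
Definition leading_positive (s : nat -> int) : Prop :=
  exists2 k, 0 < s k & forall n, (n < k)%N -> s n = 0.

Lemma leading_positive_add s t : leading_positive s -> leading_positive t ->
  leading_positive (fun n => s n + t n).
Proof.
case=> k sk sk0 [m tm tm0]; have [lt_km|lt_mk|eq_km] := ltngtP k m.
- exists k; first by rewrite tm0 ?addr0.
  by move=> n lt_nk; rewrite sk0 ?tm0 ?addr0 //; apply: ltn_trans lt_km.
- exists m; first by rewrite sk0 ?add0r.
  by move=> n lt_nm; rewrite sk0 ?tm0 ?addr0 //; apply: ltn_trans lt_mk.
- exists k; first by rewrite eq_km in sk *; lia.
  by move=> n lt_nk; rewrite sk0 ?tm0 ?addr0 // -eq_km.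
Qed.

Lemma leading_positive_total (s : nat -> int) n :
  s n != 0 -> leading_positive s \/ leading_positive (fun k => - s k).
Proof.
move=> sn; have ex : exists k, s k != 0 by exists n.
case: (ex_minnP ex) => k sk min_k.
have below m : (m < k)%N -> s m = 0.
  move=> lt_mk; apply/eqP; apply: contraTT lt_mk; rewrite -leqNgt.
  exact: min_k.
have [lt|lt] : 0 < s k \/ 0 < - s k by lia.
  by left; exists k.
by right; exists k => // m /below ->; rewrite oppr0.
Qed.

Lemma mx_coefs_entry (M : 'M[{poly int}]_2) n (i j : 'I_2) :
  mx_coefs M (n * 4 + (i * 2 + j)) = (M i j)`_n.
Proof.
have lt_i := ltn_ord i; have lt_j := ltn_ord j.
rewrite /mx_coefs; congr (M _ _)`_ _.
- by apply: val_inj; rewrite /= inordK; lia.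
- by apply: val_inj; rewrite /= inordK; lia.
- lia.
Qed.

Lemma mx_coefs_sandwich U M W : unipotent U -> unipotent W ->
  leading_positive (mx_coefs M) -> leading_positive (mx_coefs (U *m M *m W)).
Proof.
move=> uU uW [k Mk Mk0]; have vM : vanishes_below (k %/ 4) M.
  move=> n lt_n i j; rewrite -mx_coefs_entry Mk0 //.
  by have lt_i := ltn_ord i; have lt_j := ltn_ord j; lia.
have same n : (n <= k)%N -> mx_coefs (U *m M *m W) n = mx_coefs M n.
  move=> le_nk; rewrite /mx_coefs (unipotent_sandwich_coef _ _ uU uW vM) //.
  exact: leq_div2r.
exists k; first by rewrite same.
by move=> n lt_nk; rewrite same ?Mk0 // ltnW.
Qed.

Definition free_le : rel (free_group 'I_2) := fun g h =>
  `[< g = h \/ leading_positive (mx_coefs (free_mx h - free_mx g)) >].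

Lemma mx_coefsD M N n : mx_coefs (M + N) n = mx_coefs M n + mx_coefs N n.
Proof. by rewrite /mx_coefs mxE coefD. Qed.

Lemma mx_coefsN M n : mx_coefs (- M) n = - mx_coefs M n.
Proof. by rewrite /mx_coefs mxE coefN. Qed.

Lemma free_group_order : total_group_order free_le.
Proof.
have trans g h k : leading_positive (mx_coefs (free_mx h - free_mx g)) ->
    leading_positive (mx_coefs (free_mx k - free_mx h)) ->
    leading_positive (mx_coefs (free_mx k - free_mx g)).
  move=> gh hk; have := leading_positive_add hk gh.
  congr leading_positive; apply: funext => n.
  by rewrite -mx_coefsD addrA subrK.
split.
- move=> g h /andP[/asboolP[//|gh] /asboolP[//|hg]].
  have [k] := trans _ _ _ gh hg.
  by rewrite subrr /mx_coefs mxE coef0 ltxx.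
- move=> h g k /asboolP[->//|gh] /asboolP[<-|hk]; apply/asboolP; right=> //.
  exact: trans gh hk.
- move=> g h; have [->|neq_gh] := eqVneq g h.
    by apply/orP; left; apply/asboolP; left.
  have [n] : exists n, mx_coefs (free_mx h - free_mx g) n != 0.
    apply: contrapT => /forallNP zero; case/eqP: neq_gh.
    apply: free_mx_inj; apply/esym/eqP; rewrite -subr_eq0.
    apply/eqP/matrixP=> i j.
    apply/polyP=> n; rewrite -mx_coefs_entry [RHS]/= mxE coef0.
    by apply/eqP; apply: contrapT => /negP /zero.
  case/leading_positive_total => pos; apply/orP; [left|right];
    apply/asboolP; right=> //.
  move: pos; congr leading_positive; apply: funext => k.
  by rewrite -mx_coefsN opprB.
- move=> g h x y /asboolP[->|gh]; apply/asboolP; [by left|right].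
  rewrite !free_mxM -mulmxBl -mulmxBr.
  by apply: mx_coefs_sandwich gh; apply: unipotent_free_mx.
Qed.

End FreeGroupOrder.

(** * The union of two opposite energy conditions *)

Local Open Scope classical_set_scope.

(** If infinitely many terms exceed all later ones, these terms decrease;
otherwise, from some index on, every term is exceeded by a later one. *)
Lemma monotone_subsequence (G : groupType) (le : rel G) (u : nat -> G) :
    total_group_order le -> injective u ->
  exists psi : nat -> nat, {homo psi : i j / i < j} /\
    exists up, forall k, strict (directed le up) (u (psi k.+1)) (u (psi k)).
Proof.
move=> leG inj_u; pose peak n := forall m, n < m -> strict le (u m) (u n).
have [often|/existsNP[N noN]] := pselect (forall n, exists m, n < m /\ peak m).
  have [n0 [_ peak0]] := often 0.
  have [|psi [psi_incr _ psi_r]] := @increasing_extraction peak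
      (fun n m => strict le (u m) (u n)) n0 peak0.
    move=> n peak_n; have [m [lt_nm peak_m]] := often n.
    by exists m; split=> //; apply: peak_n.
  by exists psi; split=> //; exists true.
have [//||psi [psi_incr _ psi_r]] := @increasing_extraction (fun n => N < n)
    (fun n m => strict le (u n) (u m)) N.+1.
  move=> n lt_Nn; have /existsNP[m /not_implyP[lt_nm nlt]] : ~ peak n.
    by move=> peak_n; apply: noN; exists n.
  exists m; split=> //; first exact: ltn_trans lt_nm.
  move/negP: nlt; rewrite negbK strictE // => ->; rewrite andbT.
  by apply/eqP=> /inj_u eq_nm; rewrite eq_nm ltnn in lt_nm.
by exists psi; split=> //; exists false.
Qed.

Section Values.
Variables (G : groupType) (C : finType) (v : C -> G).

Lemma energy_union (le : rel G) (alpha : nat -> C) (phi : nat -> nat) :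
    total_group_order le -> {homo phi : i j / i < j} ->
    injective (fun k => value v alpha (phi k).+1) ->
  (energy_condition le v `|` energy_condition (directed le false) v) alpha.
Proof.
move=> leG phi_incr /(monotone_subsequence leG)[psi [psi_incr [up decr]]].
suff : energy_condition (directed le up) v alpha by case: (up); [left | right].
apply/energyP; first exact: directed_group_order.
by exists (phi \o psi); split=> // i j /psi_incr/phi_incr.
Qed.

Lemma two_values_not_energy (le : rel G) (alpha : nat -> C) g h :
    total_group_order le ->
    (forall n, value v alpha n = g \/ value v alpha n = h) ->
  ~ energy_condition le v alpha.
Proof.
move=> leG two /(energyP v leG)[phi [_ decr]].
have := decr 0%N; have := decr 1%N.
have := strict_trans leG (decr 1%N) (decr 0%N).
by case: (two (phi 0%N).+1) => ->; case: (two (phi 1%N).+1) => ->;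
   case: (two (phi 2%N).+1) => ->; rewrite ?strict_irr.
Qed.

End Values.

Local Notation color := (option letter).

Definition color_val (c : color) : free_group 'I_2 :=
  if c is Some l then @FreeGroup _ [:: l] isT else 1.

Lemma letters_val_word (w : seq color) :
  letters (val_word color_val w) = foldr (@push_letter _) [::] (pmap id w).
Proof.
rewrite /val_word; elim: w => [|c w IHw] /=; first by rewrite big_nil.
by rewrite big_cons /= IHw; case: c.
Qed.

Definition duel_node := (unit + 'I_2)%type.

(** The node [inl tt] is Alice's, from which she moves to one of the two nodes
of Bob with the neutral color [None]; from [inr i], Bob returns with the
generator x_i or its inverse. *)
Definition duel_edges : {set duel_node * color * duel_node} :=
  [set e | match e with
           | (inl _, None, inr _) => true
           | (inr i, Some l, inl _) => l.1 == i
           | _ => false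
           end].

Lemma duel_go (i : 'I_2) : (inl tt, None, inr i) \in duel_edges.
Proof. by rewrite inE. Qed.

Lemma duel_back (i : 'I_2) b : (inr i, Some (i, b), inl tt) \in duel_edges.
Proof. by rewrite inE eqxx. Qed.

Lemma duel_total (s : duel_node) : exists c t, (s, c, t) \in duel_edges.
Proof.
case: s => [[]|i]; first by exists None, (inr ord0); apply: duel_go.
by exists (Some (i, true)), (inl tt); apply: duel_back.
Qed.

Definition duel : arena color := Arena duel_total.

Definition go i : edge duel :=
  exist (fun e => e \in edges duel) _ (duel_go i).
Definition back i b : edge duel :=
  exist (fun e => e \in edges duel) _ (duel_back i b).

Lemma source_center (e : edge duel) : source e = inl tt -> exists i, e = go i.
Proof.
case: e => -[[s c] t] eE /= src; rewrite /source /= in src; subst s.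
have shape := eE; rewrite inE in shape; case: c shape eE => //.
case: t => // i _ eE.
by exists i; apply: val_inj.
Qed.

Lemma source_side (e : edge duel) i :
  source e = inr i -> exists b, e = back i b.
Proof.
case: e => -[[s c] t] eE /= src; rewrite /source /= in src; subst s.
have shape := eE; rewrite inE in shape; case: c shape eE => // -[j b].
case: t => // -[] /eqP /= ji eE.
by exists b; apply: val_inj; rewrite /= ji.
Qed.

(** Bob answers the constant choice of Alice with the generator and its inverse
in turn. *)
Lemma duel_positional_loses (sigma : positional_strategy duel Alice) le :
    total_group_order le ->
  ~ winning (energy_condition le color_val `|`
      energy_condition (directed le false) color_val)
    (strategy_of_positional sigma) (inl tt).
Proof.
move=> leG win; have [i sigma_i] := source_center (source_pos_move sigma tt).
pose pi n : edge duel := if odd n then back i (~~ odd n./2) else go i.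
have source_pi n : source (pi n) = if odd n then inr i else inl tt.
  by rewrite /pi; case: odd.
have {win} := win pi.
have play : play_from (A := duel) (inl tt) pi.
  by split=> // n; rewrite source_pi /pi /=; case: odd.
have cons : consistent (strategy_of_positional sigma) pi.
  move=> n u; rewrite source_pi /pi; case: odd => // _.
  by case: u.
move=> /(_ play cons); have values n :
    value color_val (@col _ duel \o pi) n =
    if odd n./2 then color_val (Some (i, true)) else 1.
  elim: n => [|n IHn]; first by rewrite /val_word big_nil.
  rewrite valueS IHn /= uphalf_half oddD oddb /pi.
  case: (odd n) => /=; last by rewrite mulg1.
  case: odd => /=; last by rewrite mul1g.
  by apply: val_inj; rewrite /= eqxx.
have two n : value color_val (@col _ duel \o pi) n = 1 \/
    value color_val (@col _ duel \o pi) n = color_val (Some (i, true)).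
  by rewrite values; case: ifP; [right | left].
by case; apply: two_values_not_energy two => //;
   apply: (directed_group_order false).
Qed.

(** Letters with alternating generators form a reduced word, whatever their
exponents, so the value after 2k moves has length k. *)
Lemma alternating_injective (alpha : nat -> color) (l : nat -> letter) :
    (forall k, alpha k.*2 = None) -> (forall k, alpha k.*2.+1 = Some (l k)) ->
    (forall k, (l k.+1).1 != (l k).1) ->
  injective (fun k => value color_val alpha k.*2).
Proof.
move=> even odd alt; have pmap_alpha k : pmap id (mkseq alpha k.*2) = mkseq l k.
  elim: k => // k IHk.
  by rewrite doubleS !mkseqS -!cats1 !pmap_cat IHk /= even odd /= cats0.
suff size_val k : size (letters (value color_val alpha k.*2)) = k.
  by move=> i j /= eq_ij; rewrite -(size_val i) eq_ij size_val.
rewrite letters_val_word pmap_alpha foldr_reduced ?size_mkseq //.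
apply/(sortedP (l 0)) => i; rewrite size_mkseq => lt_i.
rewrite !nth_mkseq //; last exact: ltnW.
by apply: contra (alt i) => /eqP ->.
Qed.

(** The play in which Alice alternates between the generators and Bob follows
tau is won by Alice. *)
Lemma duel_bob_loses (tau : strategy duel Bob) le : total_group_order le ->
  ~ winning (energy_condition le color_val `|`
      energy_condition (directed le false) color_val) tau (inl tt).
Proof.
move=> leG win; pose side n : 'I_2 := inord (odd n./2).
pose next n h := if odd n then tau h (side n) else go (side n).
pose hist := fix hist n :=
  if n is m.+1 then rcons (hist m) (next m (hist m)) else [::].
pose pi n := next n (hist n).
have mkseq_pi n : mkseq pi n = hist n.
  by elim: n => // n IHn; rewrite mkseqS IHn.
have pi_odd n : odd n -> exists b, pi n = back (side n) b.
  by move=> n_odd; apply: source_side; rewrite /pi /next n_odd source_move.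
have pi_even n : ~~ odd n -> pi n = go (side n).
  by rewrite /pi /next => /negPf ->.
have /win : play_from (A := duel) (inl tt) pi.
  split=> // n; have [n_odd|n_even] := boolP (odd n).
    by have [b ->] := pi_odd n n_odd; rewrite pi_even //= n_odd.
  have [|b ->] := pi_odd n.+1; first exact: n_even.
  rewrite pi_even //; congr inr; rewrite /side /= uphalf_half.
  by rewrite (negPf n_even).
have cons : consistent tau pi.
  move=> n u; rewrite mkseq_pi; have [n_odd|/pi_even ->//] := boolP (odd n).
  rewrite {2}/pi /next n_odd; have [b ->] := pi_odd n n_odd.
  by case=> ->.
move=> /(_ cons); apply.
pose l k := odflt (ord0, true) (col (pi k.*2.+1)).
have col_odd k : (col (pi k.*2.+1) = Some (l k)) /\ (l k).1 = side k.*2.+1.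
  have [|b pi_k] := pi_odd k.*2.+1; first by rewrite /= odd_double.
  by rewrite /l pi_k.
apply: (energy_union (phi := fun k => k.*2.+1)) => // [i j|].
  by rewrite ltnS ltn_double.
have inj : injective (fun k => value color_val (@col _ duel \o pi) k.*2).
  apply: (alternating_injective (l := l)) => k /=.
  - by rewrite pi_even ?odd_double.
  - by case: (col_odd k).
  - rewrite (col_odd k).2 (col_odd k.+1).2 /side -val_eqE /=.
    by rewrite !uphalf_double !inordK //=; case: odd.
by move=> i j; rewrite -!doubleS => /inj [].
Qed.

Theorem mainTheorem1 :
  exists C : finType, (0 < #|C|)%N /\
  exists W1 W2 : set (nat -> C),
    [/\ prefix_independent W1 /\ prefix_independent W2,
        bi_positional W1 /\ bi_positional W2,
        is_energy_condition_over (free_group 'I_2) W1 /\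
        is_energy_condition_over (free_group 'I_2) W2 &
        ~ half_positional (W1 `|` W2)].
Proof.
have leF := free_group_order; have leF' := directed_group_order false leF.
exists color; split; first by apply/card_gt0P; exists None.
exists (energy_condition free_le color_val),
  (energy_condition (directed free_le false) color_val); split.
- by split; apply: energy_prefix_independent.
- by split; apply: energy_bi_positional.
- split; [exists free_le | exists (directed free_le false)];
    by exists color_val.
- move=> /(_ duel)[sigma /(_ (inl tt))[|tau]].
    exact: duel_positional_loses.
  exact: duel_bob_loses.
Qed.
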